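(* Let $X$ be a Banach space with a conditional 1-spreading basis $(e_i)_i$. Let $(u_i)_i$ denote the subsymmetric skipped difference sequence of $(e_i)_i$, i.e. $u_i=e_{2i}-e_{2i-1}$ for all $i\in\mathbb{N}$. Then there exists a Banach space $Z$ with a 1-convex block homogeneous basis $(z_i)_i$ such that for all scalars $a_1,\ldots,a_n$ we have $$\frac12\max\Big\{\Big\|\sum_{i=1}^na_iu_i\Big\|,\Big\|\sum_{i=1}^na_iz_i\Big\|\Big\}\leqslant\Big\|\sum_{i=1}^na_ie_i\Big\|\leqslant2\max\Big\{\Big\|\sum_{i=1}^na_iu_i\Big\|,\Big\|\sum_{i=1}^na_iz_i\Big\|\Big\}.$$ Furthermore, the sequence $(u_i)_i$ is suppression unconditional and the norm on $Z$ is given by $$\Big\|\sum_{i=1}^na_iz_i\Big\|=\lim_{N\to\infty}\Big\|\sum_{i=1}^na_i\Big(\frac1N\sum_{j=(i-1)N+1}^{iN}e_j\Big)\Big\|=\inf\Big\{\Big\|\sum_{i=1}^na_iw_i\Big\|:(w_i)_{i=1}^n\text{ is a convex block sequence of }(e_i)_i\Big\}.$$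
   Context: Banach spaces are real. A sequence is 1-spreading if it is isometrically equivalent to all of its subsequences. A conditional 1-spreading basis is a Schauder basis that is 1-spreading and not unconditional. Subsymmetric means unconditional and spreading (equivalent to all of its subsequences). A sequence is suppression unconditional if the norm of a linear combination does not increase when any subset of its coefficients is deleted (replaced by zero). A convex block sequence of $(x_i)_i$ is a (finite or infinite) sequence $(w_k)_k$ with $w_k=\sum_{i\in F_k}c_ix_i$, where $F_1<F_2<\cdots$ are successive finite subsets of $\mathbb{N}$, $c_i\geqslant0$ and $\sum_{i\in F_k}c_i=1$. A Schauder basic sequence is 1-convex block homogeneous if it is isometrically equivalent to each of its convex block sequences. *)

(* Defs.v *)
From HB Require Import structures.
From mathcomp Require Import all_boot all_order all_algebra finmap.
From mathcomp Require Import all_classical all_reals all_analysis.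

Set Implicit Arguments.
Unset Strict Implicit.
Unset Printing Implicit Defensive.

Import Order.TTheory GRing.Theory Num.Theory.
Import numFieldNormedType.Exports.

Local Open Scope classical_set_scope.
Local Open Scope ring_scope.

(* Sequences are indexed from 0: the vector [e i] here is the one that is
   numbered [i + 1] when sequences are indexed by the positive integers. *)

Section Bases.
Context {R : realType} {X : completeNormedModType R}.
Implicit Types (e : nat -> X) (Y : set X).

Definition closed_span e : set X :=
  closure [set x | exists n (a : nat -> R), x = \sum_(i < n) a i *: e i].

(* For [Y] the closed linear span of [e] or the whole space. *)
Definition schauder_basis_of Y e : Prop :=
  forall x, Y x ->
    exists! a : nat -> R, series (fun i => a i *: e i) @ \oo --> x.

Definition schauder_basis e : Prop := schauder_basis_of setT e.

Definition basic_sequence e : Prop := schauder_basis_of (closed_span e) e.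

(* Every convergent expansion along [e] converges unconditionally. *)
Definition unconditional e : Prop :=
  forall a : nat -> R, cvgn (series (fun i => a i *: e i)) ->
  forall s : nat -> nat, bijective s ->
    cvgn (series (fun i => a (s i) *: e (s i))).

Definition suppression_unconditional e : Prop :=
  forall n (a : nat -> R) (A : pred nat),
    `|\sum_(i < n | A i) a i *: e i| <= `|\sum_(i < n) a i *: e i|.

End Bases.

Section Equivalence.
Context {R : realType} {X Y : completeNormedModType R}.
Implicit Types (x : nat -> X) (y : nat -> Y).

(* Isometric equivalence of the finite sequences formed by the first [n]
   terms. *)
Definition isometrically_equivalent_upto n x y : Prop :=
  forall a : nat -> R,
    `|\sum_(i < n) a i *: x i| = `|\sum_(i < n) a i *: y i|.

Definition isometrically_equivalent x y : Prop :=
  forall n, isometrically_equivalent_upto n x y.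

Definition equivalent x y : Prop :=
  exists A B : R, [/\ 0 < A, 0 < B &
    forall n (a : nat -> R),
      A * `|\sum_(i < n) a i *: x i| <= `|\sum_(i < n) a i *: y i|
      <= B * `|\sum_(i < n) a i *: x i|].

End Equivalence.

Section Sequences.
Context {R : realType} {X : completeNormedModType R}.
Implicit Types (e x w : nat -> X).

Definition one_spreading e : Prop :=
  forall k : nat -> nat, {homo k : i j / (i < j)%N} ->
    isometrically_equivalent e (e \o k).

Definition spreading e : Prop :=
  forall k : nat -> nat, {homo k : i j / (i < j)%N} -> equivalent e (e \o k).

Definition conditional_one_spreading_basis e : Prop :=
  [/\ schauder_basis e, one_spreading e & ~ unconditional e].

Definition subsymmetric e : Prop :=
  [/\ basic_sequence e, unconditional e & spreading e].

Definition skipped_difference e : nat -> X :=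
  fun i => e i.*2.+1 - e i.*2.

(* [D] is the index set of the blocks: [predT] for an infinite convex block
   sequence, the initial segment of length [n] for a finite one; the values of
   [w] outside [D] are irrelevant. The [F k] are nonempty because the
   coefficients on each of them add up to 1. *)
Definition convex_block_sequence (D : pred nat) x w : Prop :=
  exists (F : nat -> {fset nat}) (c : nat -> R),
    [/\ forall k l i j, D k -> D l -> (k < l)%N ->
          i \in F k -> j \in F l -> (i < j)%N,
        forall k i, D k -> i \in F k -> 0 <= c i,
        forall k, D k -> \sum_(i <- F k) c i = 1 &
        forall k, D k -> w k = \sum_(i <- F k) c i *: x i].

Definition infinite_convex_block_sequence x w : Prop :=
  convex_block_sequence predT x w.

Definition finite_convex_block_sequence n x w : Prop :=
  convex_block_sequence (fun k => (k < n)%N) x w.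

Definition one_convex_block_homogeneous x : Prop :=
  [/\ basic_sequence x,
      forall w, infinite_convex_block_sequence x w ->
        isometrically_equivalent x w &
      forall n w, finite_convex_block_sequence n x w ->
        isometrically_equivalent_upto n x w].

End Sequences.

(* Main.v *)
(* For a grouping of the indices into successive classes, averaging the spread
   copies of a vector in which each class is shifted by s = 0, .., N - 1 shows
   that replacing every e_j by the average of e over a block of length N attached
   to the class of j does not increase the norm, up to O(1/N). Hence the norms
   of sums of a_i avg_(N,i) converge to the infimum over convex blocks, and the
   limit is a seminorm p on finitely supported sequences (here polynomials) that
   decreases under grouping.

   If p(z_0) = 0, some averages of e are arbitrarily small, and replacing e_k by
   them deletes the k-th term, so e is suppression unconditional. If p(z_0) > 0
   but p(z_0 - z_1) = 0, the averages of e converge to a nonzero shift-invariant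
   vector, impossible for a basis. So p(z_0 - z_1) > 0 when e is conditional, and
   grouping tails makes p a norm for which (z_i) is basic; Z is its completion.

   Averaging a_i (e_(p_i + j) - e_(p_i)) over j compares e with u and p, and
   telescoping averages of e_(j+1) - e_j delete terms of u. *)
Require Import Defs.
From HB Require Import structures.
From mathcomp Require Import all_boot all_order all_algebra finmap.
From mathcomp Require Import all_classical all_reals all_analysis.
From mathcomp Require Import ring lra zify.

Import Order.TTheory GRing.Theory Num.Theory.
Import numFieldNormedType.Exports.

Local Open Scope classical_set_scope.
Local Open Scope ring_scope.
Set Implicit Arguments.
Unset Strict Implicit.

(** * Cauchy criterion and abstract norms on finitely supported sequences *)

Lemma seq_cauchy_cvg (R : realType) (V : completeNormedModType R) (f : nat -> V) :
  (forall eps : R, 0 < eps -> exists N, forall n, (N <= n)%N -> `|f N - f n| <= eps) ->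
  cvgn f.
Proof.
move=> h; apply/cauchy_cvgP/cauchy_exP => eps eps0.
have [N hN] := h (eps / 2) ltac:(rewrite divr_gt0//).
exists (f N); exists N => // n /= Nn; rewrite -ball_normE/=.
by rewrite (le_lt_trans (hN _ Nn))// ltr_pdivrMr// ltr_pMr// ltr1n.
Qed.

(** A polynomial codes a finitely supported sequence, with ['X^i] as the [i]-th basis vector. The
    last two fields bound the partial sum projections and the coordinate functionals; the latter
    also makes the seminorm definite. *)
Record basis_norm (R : realType) := BasisNorm {
  bnorm :> {poly R} -> R;
  bnorm_const : R;
  bnormD : forall q r : {poly R}, bnorm (q + r) <= bnorm q + bnorm r;
  bnormZ : forall c (q : {poly R}), bnorm (c *: q) = `|c| * bnorm q;
  bnorm_const_gt0 : 0 < bnorm_const;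
  bnorm_take : forall m (q : {poly R}), bnorm (take_poly m q) <= bnorm_const * bnorm q;
  bnorm_coef : forall i (q : {poly R}), `|q`_i| <= bnorm_const * bnorm q }.

(** * Completion of a basis norm *)

Section Completion.
Context {R : realType} (p : basis_norm R).
Implicit Types (q r : {poly R}) (a b : nat -> R).

Definition trunc n a : {poly R} := \poly_(i < n) a i.

Lemma truncD n a b : trunc n (a + b) = trunc n a + trunc n b.
Proof. by apply/polyP => i; rewrite coefD !coef_poly; case: ifP; rewrite ?addr0. Qed.

Lemma truncZ n c a : trunc n (c *: a) = c *: trunc n a.
Proof. by apply/polyP => i; rewrite coefZ !coef_poly; case: ifP; rewrite ?mulr0. Qed.

Lemma truncB n a b : trunc n (a - b) = trunc n a - trunc n b.
Proof. by rewrite truncD -scaleN1r truncZ scaleN1r. Qed.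

Lemma trunc0 n : trunc n 0 = 0.
Proof. by rewrite -(subrr (0 : nat -> R)) truncB subrr. Qed.

Definition bcauchy a := forall eps, 0 < eps -> exists N, forall m n,
  (N <= m)%N -> (N <= n)%N -> p (trunc m a - trunc n a) <= eps.

Definition bcauchy_pred : {pred nat -> R} := fun a => `[< bcauchy a >].

Lemma bnorm0 : p 0 = 0.
Proof. by rewrite -[0]/(0:{poly R}) -(scale0r (0:{poly R})) bnormZ normr0 mul0r. Qed.

Lemma bnormN q : p (- q) = p q.
Proof. by rewrite -scaleN1r bnormZ normrN1 mul1r. Qed.

Lemma bnorm_ge0 q : 0 <= p q.
Proof.
by have := bnormD p q (- q); rewrite subrr bnorm0 bnormN -mulr2n pmulrn_lge0.
Qed.

Lemma bnorm_sum (I : Type) (s : seq I) (P : pred I) (F : I -> {poly R}) :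
  p (\sum_(i <- s | P i) F i) <= \sum_(i <- s | P i) p (F i).
Proof.
elim/big_ind2 : _ => [|x y z w xy zw|//]; first by rewrite bnorm0.
by rewrite (le_trans (bnormD _ _ _))// lerD.
Qed.

Fact bcauchy_submod : submod_closed bcauchy_pred.
Proof.
split=> [|c a b /asboolP ha /asboolP hb]; apply/asboolP => eps eps0.
  by exists 0%N => m n _ _; rewrite !trunc0 subrr bnorm0 ltW.
have [N hN] := ha (eps / 2 / (`|c| + 1)) ltac:(rewrite !divr_gt0// ltr_wpDl//).
have [M hM] := hb (eps / 2) ltac:(rewrite divr_gt0//).
exists (maxn N M) => m n; rewrite !geq_max => /andP[Nm Mm] /andP[Nn Mn].
rewrite !truncD !truncZ opprD addrACA -scalerBr.
rewrite (le_trans (bnormD _ _ _))// [leRHS]splitr lerD ?hM//.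
have c1 : 0 < `|c| + 1 by rewrite ltr_wpDl.
rewrite bnormZ (le_trans (ler_wpM2l _ (hN _ _ Nm Nn)))//.
rewrite mulrCA ger_pMr ?divr_gt0// ler_pdivrMr// mul1r lerDl//.
Qed.

HB.instance Definition _ := GRing.isSubmodClosed.Build R (nat -> R) bcauchy_pred bcauchy_submod.

(* The basis property lets the completion be realized by coefficient sequences
   instead of a quotient of Cauchy sequences. *)
Record completion := Completion { cseq :> nat -> R; _ : cseq \in bcauchy_pred }.
HB.instance Definition _ := [isSub for cseq].
HB.instance Definition _ := [Choice of completion by <:].
HB.instance Definition _ := [SubChoice_isSubLmodule of completion by <:].

Implicit Types (x y : completion).

Lemma cseqP x : bcauchy x.
Proof. by apply/asboolP; case: x. Qed.

Lemma cseqD x y : cseq (x + y) = cseq x + cseq y. Proof. by []. Qed.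

Lemma cseqB x y : cseq (x - y) = cseq x - cseq y. Proof. by []. Qed.

Lemma cseqZ c x : cseq (c *: x) = c *: cseq x. Proof. by []. Qed.

Lemma bnorm_dist q r : `|p q - p r| <= p (q - r).
Proof.
have le q' r' : p q' - p r' <= p (q' - r').
  by rewrite lerBlDr -{1}(subrK r' q') bnormD.
by rewrite ler_norml le andbT lerNl opprB -(bnormN (q - r)) opprB le.
Qed.

Lemma bnorm_trunc_cvg x : cvgn (fun n => p (trunc n x)).
Proof.
apply: (@seq_cauchy_cvg _ R) => eps /(cseqP x)[N hN].
by exists N => n Nn; rewrite (le_trans (bnorm_dist _ _))// hN.
Qed.

Definition cnorm x : R := limn (fun n => p (trunc n x)).

Lemma cnorm_cvg x : p (trunc n x) @[n --> \oo] --> cnorm x.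
Proof. exact: bnorm_trunc_cvg. Qed.

Lemma take_trunc m n a : (m <= n)%N -> take_poly m (trunc n a) = trunc m a.
Proof.
move=> mn; apply/polyP => i; rewrite coef_take_poly !coef_poly.
by case: ifP => // im; rewrite (leq_trans im).
Qed.

Lemma cnorm_le x C : (\forall n \near \oo, p (trunc n x) <= C) -> cnorm x <= C.
Proof. by move=> h; apply: limr_le h; exact: bnorm_trunc_cvg. Qed.

Lemma bnorm_trunc_le n x : p (trunc n x) <= bnorm_const p * cnorm x.
Proof.
rewrite -ler_pdivrMl ?bnorm_const_gt0//.
apply: limr_ge; first exact: bnorm_trunc_cvg.
exists n => // m /= nm.
by rewrite ler_pdivrMl ?bnorm_const_gt0// -(take_trunc x nm) bnorm_take.
Qed.

Lemma cseq_le i x : `|cseq x i| <= bnorm_const p * cnorm x.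
Proof.
rewrite -ler_pdivrMl ?bnorm_const_gt0//.
apply: limr_ge; first exact: bnorm_trunc_cvg.
exists i.+1 => // m /= im; rewrite ler_pdivrMl ?bnorm_const_gt0//.
by rewrite (le_trans _ (bnorm_coef _ i _))// coef_poly im.
Qed.

Fact cnormD x y : cnorm (x + y) <= cnorm x + cnorm y.
Proof.
apply: (@ler_cvg_to _ \oo _ R (fun n => p (trunc n (x + y)))
  (fun n => p (trunc n x) + p (trunc n y))).
- exact: cnorm_cvg.
- by apply: cvgD; exact: cnorm_cvg.
by apply: nearW => n; rewrite cseqD truncD bnormD.
Qed.

Fact cnormZ c x : cnorm (c *: x) = `|c| * cnorm x.
Proof.
apply: cvg_lim => //; under eq_fun do rewrite cseqZ truncZ bnormZ.
by apply: cvgMl_tmp; exact: cnorm_cvg.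
Qed.

Fact cnorm0_eq0 x : cnorm x = 0 -> x = 0.
Proof.
move=> x0; apply/val_inj/funext => i /=; apply/eqP.
by rewrite -normr_le0 (le_trans (cseq_le i x))// x0 mulr0.
Qed.

HB.instance Definition _ :=
  Lmodule_isNormed.Build R completion cnormD cnormZ cnorm0_eq0.

Lemma cnormE x : `|x| = cnorm x. Proof. by []. Qed.

(** Only finitely many coordinates matter: by the triangle inequality, [p] is dominated there by a
    weighted sum of the absolute values of the coefficients. *)
Lemma bnorm_trunc_cvg0 n (T : Type) (F : set_system T) (FF : Filter F) (f : T -> nat -> R) :
  (forall i, f t i @[t --> F] --> (0 : R)) -> p (trunc n (f t)) @[t --> F] --> (0 : R).
Proof.
move=> f0; apply: (@squeeze_cvgr _ _ _ _ (fun=> 0) (fun t => \sum_(i < n) `|f t i| * p 'X^i)).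
- apply: nearW => t; rewrite bnorm_ge0 /trunc poly_def (le_trans (bnorm_sum _ _ _))//.
  by apply: ler_sum => i _; rewrite bnormZ.
- exact: cvg_cst.
- rewrite -[X in _ --> X](_ : \sum_(i < n) `|0 : R| * p 'X^i = 0); last first.
    by rewrite big1// => i _; rewrite normr0 mul0r.
  apply: cvg_big => [|i _]; first exact: add_continuous.
  by apply: cvgMr_tmp; apply: cvg_norm; exact: f0.
Qed.

(** Bounded coordinates give a coordinatewise limit [a]. Bounds on truncations, uniform in their
    length, show that [a] lies in the space and is the norm limit. *)
Lemma completion_complete (F : set_system completion) :
  ProperFilter F -> cauchy F -> cvg F.
Proof.
move=> FF cF.
have K0 := bnorm_const_gt0 p.
have cvgi i : cvg ((fun x : completion => cseq x i) @ F).
  apply: cauchy_cvg; apply/cauchy_exP => eps eps0.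
  have [x Fx] := (@cauchyP _ _ F _).1 cF _ (divr_gt0 eps0 K0).
  exists (cseq x i).
  suff : F [set y : completion | ball (cseq x i) eps (cseq y i)] by [].
  apply: filterS Fx => y; rewrite -!ball_normE/= cnormE => xy.
  rewrite (le_lt_trans (cseq_le i (x - y)))//.
  by rewrite mulrC -ltr_pdivlMr.
pose a i : R := lim ((fun x : completion => cseq x i) @ F).
(* For fixed [n], compare [x] with [y] by the bounded truncation map, then let [y] run along [F];
   the bound does not depend on [n]. *)
have near_le eps : 0 < eps ->
    \forall x \near F, forall n, p (trunc n (cseq x - a)) <= eps.
  move=> eps0; have h : \forall x & y \near F, ball x (eps / bnorm_const p) y.
    by apply/(cauchy_ballP F).2 => //; exact: divr_gt0.
  near=> x => n.
  have hx : \forall y \near F, ball x (eps / bnorm_const p) y.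
    by near: x; exact: (nearP_dep h).
  suff : p (trunc n (cseq x - a)) - 0 <= eps by rewrite subr0.
  have c : p (trunc n (cseq x - a)) - p (trunc n (cseq y - a)) @[y --> F]
      --> p (trunc n (cseq x - a)) - 0.
    apply: cvgB; first exact: cvg_cst.
    apply: bnorm_trunc_cvg0 => i.
    rewrite -[0](subrr (a i)); apply: cvgB; last exact: cvg_cst.
    exact: cvgi.
  rewrite -(cvg_lim _ c)//; apply: limr_le; first by apply/cvg_ex; eexists; exact: c.
  apply: filterS hx => y; rewrite -ball_normE/= cnormE => xy.
  rewrite (le_trans (ler_norm _))// (le_trans (bnorm_dist _ _))//.
  rewrite -truncB opprB addrA subrK -cseqB (le_trans (bnorm_trunc_le _ _))//.
  by rewrite mulrC -ler_pdivlMr// ltW.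
have ca : a \in bcauchy_pred.
  apply/asboolP => eps eps0.
  have e3 : 0 < eps / 3 by rewrite divr_gt0.
  have [x hx] := filter_ex (near_le _ e3).
  have [N hN] := cseqP x e3.
  exists N => m n Nm Nn.
  have -> : trunc m a - trunc n a = - trunc m (cseq x - a) + trunc n (cseq x - a)
      + (trunc m x - trunc n x).
    by rewrite !truncB opprB addrAC !subrKA.
  rewrite (le_trans (bnormD _ _ _))// (le_trans (lerD (bnormD _ _ _) (hN _ _ Nm Nn)))//.
  rewrite bnormN (le_trans (lerD (lerD (hx _) (hx _)) (lexx _)))//.
  by lra.
apply/cvg_ex; exists (Completion ca).
apply/cvgrPdist_le => eps eps0.
apply: filterS (near_le _ eps0) => x hx.
rewrite distrC cnormE; apply: cnorm_le; apply: nearW => n.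
by rewrite cseqB.
Unshelve. all: by end_near. Qed.

HB.instance Definition _ := Uniform_isComplete.Build completion completion_complete.

Lemma trunc_poly n q : (size q <= n)%N -> trunc n (nth 0 q) = q.
Proof.
move=> qn; apply/polyP => i; rewrite coef_poly; case: ltnP => // ni.
by rewrite nth_default// (leq_trans qn).
Qed.

Fact bcauchy_poly q : (nth 0 q : nat -> R) \in bcauchy_pred.
Proof.
apply/asboolP => eps eps0; exists (size q) => m n qm qn.
by rewrite !trunc_poly// subrr bnorm0 ltW.
Qed.

Definition cpoly q : completion := Completion (bcauchy_poly q).

Lemma cpoly_norm q : `|cpoly q| = p q.
Proof.
apply: cvg_lim => //; apply: cvg_near_cst.
by exists (size q) => // n /= qn; rewrite trunc_poly.
Qed.

Lemma cpoly_linear : linear cpoly.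
Proof.
by move=> c q r; apply/val_inj/funext => i /=; rewrite coefD coefZ.
Qed.
HB.instance Definition _ := GRing.isLinear.Build R {poly R} completion _ cpoly cpoly_linear.

Definition cbasis i := cpoly 'X^i.

Lemma cbasis_sum n a : \sum_(i < n) a i *: cbasis i = cpoly (trunc n a).
Proof. by rewrite /trunc poly_def linear_sum; apply: eq_bigr => i _; rewrite linearZ. Qed.

(** Partial sums along the basis are truncations of the coefficient sequence, and these converge
    because it is [bcauchy]. Uniqueness follows from the continuity of the coordinates. *)
Lemma cbasis_schauder : schauder_basis cbasis.
Proof.
move=> x _; exists (cseq x); split=> [|b bx].
  apply/cvgrPdist_le => eps eps0.
  have [N hN] := cseqP x eps0.
  exists N => // n /= Nn; rewrite /series/= big_mkord cbasis_sum cnormE.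
  apply: cnorm_le; exists n => // m nm.
  rewrite cseqB truncB (trunc_poly (leq_trans (size_poly _ _) nm)).
  by rewrite hN// (leq_trans Nn).
apply/funext => i; apply/esym/eqP; rewrite -subr_eq0 -normr_le0.
apply/ler_addgt0Pl => eps eps0; rewrite addr0.
have K0 := bnorm_const_gt0 p.
have /cvgrPdist_le/(_ _ (divr_gt0 eps0 K0))[N _ hN] := bx.
(* More than [i] terms are taken, so that the [i]-th coordinate of the partial sum is [b i]. *)
have := hN (N + i.+1)%N (leq_addr _ _).
rewrite /series/= big_mkord cbasis_sum cnormE ler_pdivlMr// mulrC => /(le_trans (cseq_le i _)).
by rewrite cseqB /= [(_ - _) i]/(_ - _)/= coef_poly addnS ltnS leq_addl distrC.
Qed.
End Completion.

(** * Averages and convex blocks of 1-spreading sequences *)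

Section Spreading.
Context {R : realType} {X : completeNormedModType R}.
Implicit Types (e x w : nat -> X) (k g b : nat -> nat) (a c : nat -> R).

Lemma norm_average_le (N : nat) (v : nat -> X) (B : R) : (0 < N)%N ->
  (forall s, (s < N)%N -> `|v s| <= B) -> `|N%:R^-1 *: \sum_(s < N) v s| <= B.
Proof.
move=> N0 vB; have N0' : 0 < N%:R :> R by rewrite ltr0n.
rewrite normrZ gtr0_norm ?invr_gt0// mulrC ler_pdivrMr//.
rewrite (le_trans (ler_norm_sum _ _ _))// mulr_natr.
have -> : B *+ N = \sum_(s < N) B by rewrite sumr_const card_ord.
by apply: ler_sum => s _; exact: vB.
Qed.

Lemma eventually_div_le (C eps : R) : 0 < eps ->
  exists M, forall N, (M <= N)%N -> C / N%:R <= eps.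
Proof.
move=> eps0; exists (Num.bound (`|C| / eps)).+1 => N MN.
have N0 : 0 < N%:R :> R by rewrite ltr0n (leq_trans _ MN).
rewrite ler_pdivrMr// mulrC -ler_pdivrMr// ltW//.
have /le_lt_trans -> // : C / eps <= `|C| / eps.
  by rewrite ler_pM2r ?invr_gt0// ler_norm.
apply: lt_le_trans (archi_boundP _) _; first by rewrite divr_ge0// ltW.
by rewrite ler_nat ltnW.
Qed.

Lemma limit_le_div (f : nat -> R) (l r C : R) : f N @[N --> \oo] --> l ->
  (forall N, (0 < N)%N -> f N <= r + C / N%:R) -> l <= r.
Proof.
move=> fl fr; apply/ler_addgt0Pr => eps eps0.
rewrite -(cvg_lim _ fl)//; apply: limr_le; first by apply/cvg_ex; exists l.
have [M hM] := eventually_div_le C eps0.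
exists M.+1 => // N /= MN; rewrite (le_trans (fr _ _)) ?lerD2l ?hM//.
  exact: leq_trans MN.
exact: ltnW.
Qed.

(** The map [k] is increasing only below [n]; it is extended to a globally increasing one, as
    [one_spreading] requires. *)
Lemma spreading_upto e n k a : one_spreading e ->
  (forall i j, (i < j < n)%N -> (k i < k j)%N) ->
  `|\sum_(i < n) a i *: e (k i)| = `|\sum_(i < n) a i *: e i|.
Proof.
move=> se hk.
(* From [n] on, the values exceed the sum of all earlier ones, hence each of them. *)
pose k' i := if (i < n)%N then k i else (\sum_(j < n) k j + i).+1.
have hk' : {homo k' : i j / (i < j)%N}.
  move=> i j ij; rewrite /k'; case: (ltnP j n) => jn.
    by rewrite (ltn_trans ij jn) hk// ij.
  case: (ltnP i n) => i_n; last by rewrite ltnS ltn_add2l.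
  by rewrite ltnS (leq_trans _ (leq_addr _ _))// (bigD1 (Ordinal i_n))//= leq_addr.
rewrite (se _ hk' n a); congr `|_|; apply: eq_bigr => i _.
by rewrite /= /k' ltn_ord.
Qed.

Lemma spreading_norm e i : one_spreading e -> `|e i| = `|e 0%N|.
Proof.
move=> se; have := @spreading_upto e 1 (fun=> i) (fun=> 1) se.
rewrite !big_ord1 !scale1r; apply => j j'.
by rewrite ltnS leqn0 => /andP[/[swap] /eqP ->].
Qed.

Lemma sum_divmod n N (F : nat -> nat -> X) : (0 < N)%N ->
  \sum_(i < n) \sum_(s < N) F i s = \sum_(t < n * N) F (t %/ N)%N (t %% N)%N.
Proof.
move=> N0; elim: n => [|n IH]; first by rewrite mul0n !big_ord0.
rewrite big_ord_recr/= IH mulSn addnC big_split_ord/=; congr (_ + _).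
by apply: eq_bigr => s _; rewrite divnMDl// modnMDl divn_small ?modn_small ?addn0.
Qed.

Definition average e N i : X := N%:R^-1 *: \sum_(i * N <= j < i.+1 * N) e j.

Lemma averageE e N i : average e N i = N%:R^-1 *: \sum_(s < N) e (i * N + s)%N.
Proof.
rewrite /average mulSn -{1}[(i * N)%N]add0n big_addn addnK big_mkord.
by congr (_ *: _); apply: eq_bigr => s _; rewrite addnC.
Qed.

Lemma average_flatten e n N a g : (0 < N)%N ->
  \sum_(i < n) a i *: average e N (g i) =
  \sum_(t < n * N) (a (t %/ N)%N / N%:R) *: e (g (t %/ N) * N + t %% N)%N.
Proof.
move=> N0; rewrite -(sum_divmod n (fun i s => (a i / N%:R) *: e (g i * N + s)%N))//.
apply: eq_bigr => i _; rewrite averageE scalerA scaler_sumr.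
exact: eq_bigr.
Qed.

(** Moving whole blocks of length [N] along [k] is a strictly increasing reindexing of the flattened
    positions [i * N + s]. *)
Lemma average_spreading e n N a k : one_spreading e ->
  (forall i j, (i < j < n)%N -> (k i < k j)%N) ->
  `|\sum_(i < n) a i *: average e N (k i)| = `|\sum_(i < n) a i *: average e N i|.
Proof.
move=> se hk; have [->|N0] := posnP N.
  by congr `|_|; apply: eq_bigr => i _; rewrite !averageE !big_ord0.
rewrite (average_flatten e n a k N0) (average_flatten e n a id N0).
pose c t := a (t %/ N)%N / N%:R.
rewrite (@spreading_upto e (n * N) (fun t => k (t %/ N) * N + t %% N)%N c se); last first.
  move=> i j /andP[ij jn].
  have [E|] := eqVneq (i %/ N)%N (j %/ N)%N.
    rewrite E ltn_add2l; move: ij.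
    by rewrite {1}(divn_eq i N) {1}(divn_eq j N) E ltn_add2l.
  rewrite neq_ltn => /orP[lt|]; last by rewrite ltnNge leq_div2r// ltnW.
  have h : (k (i %/ N) < k (j %/ N))%N by rewrite hk// lt ltn_divLR.
  apply: (@leq_trans ((k (i %/ N)).+1 * N)%N).
    by rewrite mulSn addnC ltn_add2r ltn_mod.
  by rewrite (leq_trans _ (leq_addr _ _))// leq_mul2r h orbT.
by congr `|_|; apply: eq_bigr => t _; rewrite /c -divn_eq.
Qed.

(** Each shift by one position exchanges a single end term, at a cost of at most two norms
    [|e 0|]. *)
Lemma shift_sum_le e q j N : one_spreading e ->
  `|\sum_(s < N) e (q + j + s)%N - \sum_(s < N) e (q + s)%N| <= j%:R * (2 * `|e 0%N|).
Proof.
move=> se; elim: j => [|j IH].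
  by rewrite addn0 subrr normr0 mul0r.
rewrite -(subrKA (\sum_(s < N) e (q + j + s)%N)) (le_trans (ler_normD _ _))//.
rewrite -natr1 mulrDl mul1r addrC lerD//.
have -> : \sum_(s < N) e (q + j.+1 + s)%N - \sum_(s < N) e (q + j + s)%N
    = e (q + j + N)%N - e (q + j)%N.
  apply/eqP; rewrite subr_eq addrAC -subr_eq opprK; apply/eqP.
  rewrite [RHS]addrC -[RHS](big_ord_recr N (fun s => e (q + j + s)%N))/=.
  rewrite big_ord_recl [RHS]addrC/= addn0.
  by congr (_ + _); apply: eq_bigr => s _; rewrite /bump/= add1n !addnS addSn.
by rewrite (le_trans (ler_normB _ _))// !(spreading_norm _ se) mulr_natl.
Qed.

(* The maps [j |-> b j * N + j + s] are strictly increasing for every shift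
   [s < N], so averaging the spread copies over [s] does not increase the norm;
   it replaces [e j] by [average e N (b j)] up to [O(1/N)]. *)
Lemma grouping_le e L b c : one_spreading e -> {homo b : i j / (i <= j)%N} ->
  exists C, forall N, (0 < N)%N ->
    `|\sum_(j < L) c j *: average e N (b j)|
      <= `|\sum_(j < L) c j *: e j| + C / N%:R.
Proof.
move=> se hb; exists (\sum_(j < L) `|c j| * (j%:R * (2 * `|e 0%N|))) => N N0.
have N0' : 0 < N%:R :> R by rewrite ltr0n.
(* The first part averages the spread copies; the second corrects the extra shift by [j], which
   [shift_sum_le] controls. *)
have -> : \sum_(j < L) c j *: average e N (b j) =
    N%:R^-1 *: \sum_(s < N) \sum_(j < L) c j *: e (b j * N + j + s)%N -
    N%:R^-1 *: \sum_(j < L) c j *: (\sum_(s < N) e (b j * N + j + s)%N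
                                    - \sum_(s < N) e (b j * N + s)%N).
  rewrite exchange_big/= -scalerBr -sumrB scaler_sumr; apply: eq_bigr => j _.
  by rewrite -scaler_sumr -scalerBr opprB addrC subrK averageE !scalerA mulrC.
rewrite (le_trans (ler_normB _ _))// lerD//.
  apply: (norm_average_le (v := fun s => \sum_(j < L) c j *: e (b j * N + j + s)%N)) => // s sN.
  rewrite -(@spreading_upto e L (fun j => b j * N + j + s)%N)// => i j /andP[ij _].
  rewrite ltn_add2r -addnS leq_add// leq_mul2r hb ?orbT//; exact: ltnW.
rewrite normrZ gtr0_norm ?invr_gt0// mulrC ler_pM2r ?invr_gt0//.
rewrite (le_trans (ler_norm_sum _ _ _))//; apply: ler_sum => j _.
by rewrite normrZ ler_wpM2l// shift_sum_le.
Qed.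

(** Flattening the averages of length [M] reduces this to [grouping_le], with [M] consecutive
    positions sent to each class [b j]. *)
Lemma grouping_average_le e L b c M : one_spreading e ->
  {homo b : i j / (i <= j)%N} -> (0 < M)%N ->
  exists C, forall N, (0 < N)%N ->
    `|\sum_(j < L) c j *: average e N (b j)|
      <= `|\sum_(j < L) c j *: average e M j| + C / N%:R.
Proof.
move=> se hb M0.
have hb' : {homo (fun t => b (t %/ M)%N) : i j / (i <= j)%N}.
  by move=> i j ij; rewrite hb// leq_div2r.
have [C hC] := grouping_le (L * M) (fun t => c (t %/ M)%N / M%:R) se hb'.
exists C => N N0; have := hC N N0.
rewrite -(sum_divmod L (fun i _ => (c i / M%:R) *: average e N (b i)))//.
have -> : \sum_(j < L) c j *: average e M j
    = \sum_(t < L * M) (c (t %/ M)%N / M%:R) *: e t.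
  rewrite (average_flatten e L c id M0); apply: eq_bigr => t _.
  by rewrite /= -divn_eq.
congr (`|_| <= _); apply: eq_bigr => j _.
rewrite sumr_const card_ord -scaler_nat scalerA mulrCA divff ?mulr1//.
by rewrite pnatr_eq0 -lt0n.
Qed.

Lemma average_convex_block e n N : (0 < N)%N ->
  finite_convex_block_sequence n e (average e N).
Proof.
move=> N0; exists (fun i => [fset j | j in iota (i * N) N]%fset), (fun=> N%:R^-1).
have sumF (V : nmodType) i (f : nat -> V) :
    \sum_(j <- [fset j | j in iota (i * N) N]%fset) f j = \sum_(i * N <= j < i.+1 * N) f j.
  apply: perm_big; apply: uniq_perm; rewrite ?fset_uniq ?iota_uniq// => j.
  by rewrite !inE/= /index_iota mulSn addnK.
split.
- move=> k l i j _ _ kl; rewrite !inE/= !mem_iota => /andP[_ ik] /andP[lj _].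
  rewrite (leq_trans ik)// (leq_trans _ lj)// addnC -mulSn leq_mul2r kl orbT//.
- by move=> k i _ _; rewrite invr_ge0.
- move=> k _; rewrite sumF sumr_const_nat mulSn addnK -[LHS]mulr_natr mulVf//.
  by rewrite pnatr_eq0 -lt0n.
- by move=> k _; rewrite sumF /average scaler_sumr.
Qed.

(* The positions of [e] are grouped by the block they lie in. *)
Lemma convex_block_regroup e n w a : finite_convex_block_sequence n e w ->
  exists L b c, [/\ {homo b : i j / (i <= j)%N},
    \sum_(i < n) a i *: w i = \sum_(j < L) c j *: e j &
    forall (V : lmodType R) (v : nat -> V),
      \sum_(i < n) a i *: v i = \sum_(j < L) c j *: v (b j)].
Proof.
move=> [F [c [Flt c0 c1 wE]]].
pose L := (\sum_(i < n) \sum_(j <- F i) j.+1)%N.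
have FL i j : (i < n)%N -> j \in F i -> (j < L)%N.
  move=> i_n jF; rewrite /L (bigD1 (Ordinal i_n))//= (big_fsetD1 _ jF)/=.
  by rewrite -addnA leq_addr.
(* This counts the blocks other than the first that have begun by position [j]. It is monotone on
   all positions, also between blocks, and equals [i] on [F i]. *)
pose b j := (\sum_(1 <= i < n) has (fun j' => j' <= j) (F i))%N.
have hb : {homo b : i j / (i <= j)%N}.
  move=> j j' jj'; apply: leq_sum => i _.
  case: hasP => // -[m mF mj]; suff -> : has (fun m => m <= j')%N (F i) by [].
  by apply/hasP; exists m => //; exact: leq_trans jj'.
have bE i j : (i < n)%N -> j \in F i -> b j = i.
  move=> i_n jF; rewrite /b.
  have [i0|i0] := posnP i; last rewrite (big_cat_nat _ (n := i.+1))//=.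
    rewrite i0 in i_n jF *.
    rewrite big_nat big1// => m /andP[m0 mn].
    case: hasP => // -[j' j'F j'j].
    by have := Flt _ _ _ _ i_n mn m0 jF j'F; rewrite ltnNge j'j.
  rewrite [X in (_ + X)%N]big_nat [X in (_ + X)%N]big1 ?addn0; last first.
    move=> m /andP[im mn]; case: hasP => // -[j' j'F j'j].
    by have := Flt _ _ _ _ i_n mn im jF j'F; rewrite ltnNge j'j.
  transitivity (\sum_(1 <= m < i.+1) 1)%N; last by rewrite sum_nat_const_nat subSS subn0 muln1.
  rewrite !big_nat;  apply: eq_bigr => m /andP[m0 mi].
  suff -> : has (fun j' => j' <= j)%N (F m) by [].
  have mn : (m < n)%N by exact: leq_trans i_n.
  move: mi; rewrite ltnS leq_eqVlt => /orP[/eqP ->|mi].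
    by apply/hasP; exists j.
  have [Fm0|[j' j'F]] := fset_0Vmem (F m).
    have := c1 _ mn; rewrite Fm0 big_seq_fset0 => /eqP.
    by rewrite eq_sym oner_eq0.
  by apply/hasP; exists j' => //; rewrite ltnW// (Flt m i).
(* Positions outside every block keep a label but get coefficient 0. *)
pose c' j := if (j \in F (b j)) && (b j < n)%N then a (b j) * c j else 0.
have regroup (V : lmodType R) (v : nat -> nat -> V) :
    \sum_(j < L) c' j *: v j (b j) = \sum_(i < n) a i *: \sum_(j <- F i) c j *: v j i.
  have -> : \sum_(i < n) a i *: \sum_(j <- F i) c j *: v j i =
      \sum_(i < n) \sum_(j < L | (j : nat) \in F i) (a i * c j) *: v j i.
    apply: eq_bigr => i _; rewrite scaler_sumr.
    rewrite -(big_mkord (fun j => j \in F i) (fun j => (a i * c j) *: v j i)) -big_filter.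
    under [LHS]eq_bigr do rewrite scalerA.
    apply: perm_big; apply: uniq_perm; rewrite ?fset_uniq ?filter_uniq ?iota_uniq// => j.
    rewrite mem_filter mem_index_iota/=; case: (boolP (j \in F i)) => //= jF.
    by rewrite (FL i).
  rewrite (exchange_big_dep xpredT)//=; apply: eq_bigr => j _; rewrite /c'.
  case: ifPn => [/andP[jF bn]|nF].
    rewrite (bigD1 (Ordinal bn))//= big1 ?addr0// => i /andP[jFi]; rewrite -val_eqE/=.
    by rewrite (bE i j (ltn_ord i) jFi) eqxx.
  rewrite scale0r big1// => i jFi; move: nF.
  by rewrite (bE i j (ltn_ord i) jFi) jFi ltn_ord.
exists L, b, c'; split=> // [|V v].
  rewrite (regroup X (fun j _ => e j)); apply: eq_bigr => i _; by rewrite wE.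
rewrite (regroup V (fun _ i => v i)); apply: eq_bigr => i _.
by rewrite -scaler_suml c1// scale1r.
Qed.

Lemma convex_block_dominates e n w a : one_spreading e ->
  finite_convex_block_sequence n e w ->
  exists C, forall N, (0 < N)%N ->
    `|\sum_(i < n) a i *: average e N i|
      <= `|\sum_(i < n) a i *: w i| + C / N%:R.
Proof.
move=> se /(convex_block_regroup a) [L [b [c [hb wE avE]]]].
have [C hC] := grouping_le L c se hb.
by exists C => N N0; rewrite wE avE hC.
Qed.

(* Replace the blocks one at a time: each step writes a block as a convex
   combination of its terms, and the norm does not depend on the chosen terms. *)
Lemma convex_block_le e n w a : one_spreading e ->
  finite_convex_block_sequence n e w ->
  `|\sum_(i < n) a i *: w i| <= `|\sum_(i < n) a i *: e i|.
Proof.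
move=> se [F [c [Flt c0 c1 wE]]].
have step m : forall g, (m <= n)%N -> (forall i, (m <= i < n)%N -> g i \in F i) ->
    `|\sum_(i < n) a i *: (if (i < m)%N then w i else e (g i))|
      <= `|\sum_(i < n) a i *: e i|.
  elim: m => [g _ gF|m IH g mn gF].
    rewrite (spreading_upto _ se)// => i j /andP[ij jn].
    by apply: (Flt i j); rewrite ?gF ?ij ?(ltn_trans ij).
  have -> : \sum_(i < n) a i *: (if (i < m.+1)%N then w i else e (g i)) =
      \sum_(t <- F m) c t *: \sum_(i < n) a i *:
        (if (i < m)%N then w i else e (if (i : nat) == m then t else g i)).
    under [RHS]eq_bigr do rewrite scaler_sumr.
    rewrite exchange_big/=; apply: eq_bigr => i _.
    under eq_bigr do rewrite scalerA mulrC -scalerA.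
    rewrite -scaler_sumr ltnS leq_eqVlt; congr (_ *: _).
    have [->|im]/= := eqVneq (i : nat) m; first by rewrite ltnn wE.
    by rewrite -scaler_suml c1// scale1r.
  rewrite (le_trans (ler_norm_sum _ _ _))//.
  rewrite -[leRHS]mul1r -(c1 m mn) mulr_suml.
  rewrite big_seq [leRHS]big_seq; apply: ler_sum => t tF.
  rewrite normrZ ger0_norm ?(c0 m)// ler_wpM2l ?(c0 m)//.
  apply: (IH (fun j => if j == m then t else g j)) => [|i /andP[mi i_n]]; first exact: ltnW.
  case: eqVneq => [->//|im]; apply: gF; rewrite i_n andbT ltn_neqAle mi andbT.
  by rewrite eq_sym.
have := step n id (leqnn n); under eq_bigr do rewrite ltn_ord.
apply=> i; by rewrite ltnNge andbN.
Qed.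

End Spreading.

(** * The limit norm of averages *)

Section AveragingNorm.
Context {R : realType} {X : completeNormedModType R}.
Implicit Types (e x w : nat -> X) (k g b : nat -> nat) (a c : nat -> R).

Definition average_map e N (q : {poly R}) : X :=
  \sum_(i < size q) q`_i *: average e N i.

Lemma average_mapE e N n (q : {poly R}) : (size q <= n)%N ->
  average_map e N q = \sum_(i < n) q`_i *: average e N i.
Proof.
move=> qn; rewrite /average_map (big_ord_widen n (fun i => q`_i *: average e N i) qn).
rewrite big_mkcond/=; apply: eq_bigr => i _; case: ltnP => // iq.
by rewrite nth_default ?scale0r.
Qed.

Fact average_map_linear e N : linear (average_map e N).
Proof.
move=> c q r; set n := maxn (maxn (size q) (size r)) (size (c *: q + r)).
rewrite (@average_mapE _ _ n) ?leq_max ?leqnn ?orbT//.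
rewrite (@average_mapE _ _ n q) ?leq_max ?leqnn ?orbT//.
rewrite (@average_mapE _ _ n r) ?leq_max ?leqnn ?orbT//.
rewrite scaler_sumr -big_split/=; apply: eq_bigr => i _.
by rewrite coefD coefZ scalerDl scalerA.
Qed.

HB.instance Definition _ e N :=
  GRing.isLinear.Build R {poly R} X _ (average_map e N) (average_map_linear e N).

Lemma average_mapXn e N i : average_map e N 'X^i = average e N i.
Proof.
rewrite (@average_mapE _ _ i.+1) ?size_polyXn// big_ord_recr/= coefXn eqxx scale1r.
by rewrite big1 ?add0r// => j _; rewrite coefXn ltn_eqF// scale0r.
Qed.

Lemma average_map_sum e N n a g :
  average_map e N (\sum_(i < n) a i *: 'X^(g i)) = \sum_(i < n) a i *: average e N (g i).
Proof. by rewrite linear_sum; apply: eq_bigr => i _; rewrite linearZ/= average_mapXn. Qed.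

Definition convex_block_norms e n a : set R :=
  [set r : R | exists w : nat -> X,
     finite_convex_block_sequence n e w /\ r = `|\sum_(i < n) a i *: w i|].

(** Averages are convex blocks, so they stay above the infimum; a nearly optimal convex block
    dominates them up to [C / N]. *)
Lemma average_norm_cvg_inf e n a : one_spreading e ->
  `|\sum_(i < n) a i *: average e N i| @[N --> \oo] --> inf (convex_block_norms e n a).
Proof.
move=> se; set S := convex_block_norms e n a.
have SN N : (0 < N)%N -> S `|\sum_(i < n) a i *: average e N i|.
  by move=> N0; exists (average e N); split=> //; exact: average_convex_block.
have Slb : lbound S 0 by move=> _ [w [_ ->]].
have hS : has_inf S by split; [eexists; exact: (SN 1%N) | exists 0].
apply/cvgrPdist_le => eps eps0.
have eps2 : 0 < eps / 2 by rewrite divr_gt0.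
have [_ [w [hw ->]] wS] := inf_adherent eps2 hS.
have [C hC] := convex_block_dominates a se hw.
have [M hM] := eventually_div_le C eps2.
exists M.+1 => // N /= MN; have N0 : (0 < N)%N by exact: leq_trans MN.
have le1 := ge_inf hS.2 (SN _ N0).
have le2 := hC _ N0; have le3 := hM _ (ltnW MN).
by rewrite ler_distlC; apply/andP; split; lra.
Qed.

Definition average_norm e (q : {poly R}) : R := limn (fun N => `|average_map e N q|).

Lemma average_norm_cvg e q : one_spreading e ->
  `|average_map e N q| @[N --> \oo] --> average_norm e q.
Proof.
move=> se; rewrite /average_norm; apply/cvg_ex.
by exists (inf (convex_block_norms e (size q) (nth 0 q))); exact: average_norm_cvg_inf.
Qed.

Lemma average_norm_sum_cvg e n a g : one_spreading e ->
  `|\sum_(i < n) a i *: average e N (g i)| @[N --> \oo] -->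
    average_norm e (\sum_(i < n) a i *: 'X^(g i)).
Proof.
move=> se; under eq_cvg do rewrite -average_map_sum.
exact: average_norm_cvg.
Qed.

Lemma average_norm_inf e n a : one_spreading e ->
  average_norm e (\sum_(i < n) a i *: 'X^i) = inf (convex_block_norms e n a).
Proof.
move=> se; apply/esym; rewrite -(cvg_lim _ (average_norm_cvg_inf (n := n) (a := a) se))//.
by apply: cvg_lim => //; exact: (average_norm_sum_cvg (g := id) se).
Qed.

Lemma average_normD e (q r : {poly R}) : one_spreading e ->
  average_norm e (q + r) <= average_norm e q + average_norm e r.
Proof.
move=> se.
apply: (@ler_cvg_to _ \oo _ R (fun N => `|average_map e N (q + r)|)
  (fun N => `|average_map e N q| + `|average_map e N r|)).
- exact: average_norm_cvg.
- by apply: cvgD; exact: average_norm_cvg.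
- by apply: nearW => N; rewrite linearD ler_normD.
Qed.

Lemma average_normZ e (c : R) (q : {poly R}) : one_spreading e ->
  average_norm e (c *: q) = `|c| * average_norm e q.
Proof.
move=> se; apply: cvg_lim => //; under eq_fun do rewrite linearZ normrZ.
by apply: cvgMl_tmp; exact: average_norm_cvg.
Qed.

Lemma average_normN e (q : {poly R}) : one_spreading e ->
  average_norm e (- q) = average_norm e q.
Proof. by move=> se; rewrite -scaleN1r average_normZ// normrN1 mul1r. Qed.

Lemma average_norm_group_le e L b c : one_spreading e -> {homo b : i j / (i <= j)%N} ->
  average_norm e (\sum_(j < L) c j *: 'X^(b j)) <= `|\sum_(j < L) c j *: e j|.
Proof.
move=> se hb; have [C hC] := grouping_le L c se hb.
exact: limit_le_div (average_norm_sum_cvg se) hC.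
Qed.

Lemma average_norm_group e L b c : one_spreading e -> {homo b : i j / (i <= j)%N} ->
  average_norm e (\sum_(j < L) c j *: 'X^(b j))
    <= average_norm e (\sum_(j < L) c j *: 'X^j).
Proof.
(* Two limits: with [M] fixed the error [C / N] disappears as [N] grows, and only then does [M] tend
   to infinity. *)
move=> se hb; apply: limr_ge; first by apply/cvg_ex; eexists; exact: average_norm_cvg.
exists 1%N => // M /= M0; have [C hC] := grouping_average_le L c se hb M0.
rewrite (average_map_sum e M L c id).
exact: limit_le_div (average_norm_sum_cvg se) hC.
Qed.

Lemma average_norm_spreading e n a k : one_spreading e ->
  (forall i j, (i < j < n)%N -> (k i < k j)%N) ->
  average_norm e (\sum_(i < n) a i *: 'X^(k i)) = average_norm e (\sum_(i < n) a i *: 'X^i).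
Proof.
move=> se hk; rewrite /average_norm.
suff -> : (fun N => `|average_map e N (\sum_(i < n) a i *: 'X^(k i))|) =
    (fun N => `|average_map e N (\sum_(i < n) a i *: 'X^i)|) by [].
by apply/funext => N; rewrite !average_map_sum (average_map_sum e N n a id) average_spreading.
Qed.

Lemma average_normXn e i : one_spreading e -> average_norm e 'X^i = average_norm e 1.
Proof.
move=> se; have := @average_norm_spreading e 1 (fun=> 1) (fun=> i) se.
rewrite !big_ord1 !scale1r expr0; apply => j l.
by rewrite ltnS leqn0 => /andP[/[swap] /eqP ->].
Qed.

Lemma poly_sum_coef (q : {poly R}) : \sum_(j < size q) q`_j *: 'X^j = q.
Proof. by rewrite -poly_def coefK. Qed.

(** * Bounds from grouping when [1 - 'X] has positive norm *)

Section Bounds.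
Context (e : nat -> X) (se : one_spreading e)
  (indep : 0 < average_norm e (1 - 'X)).

Let p := average_norm e.
Let bound := 2 * p 1 / p (1 - 'X).

Let p_ge0 q : 0 <= p q.
Proof.
apply: limr_ge; first by apply/cvg_ex; eexists; exact: average_norm_cvg.
exact: nearW.
Qed.

Let p_group b (q : {poly R}) : {homo b : i j / (i <= j)%N} ->
  p (\sum_(j < size q) q`_j *: 'X^(b j)) <= p q.
Proof.
move=> hb; rewrite -[in leRHS](poly_sum_coef q).
exact: (average_norm_group (size q) (nth 0 q) se hb).
Qed.

(** Group all indices into the single class 0. *)
Lemma average_norm_total (q : {poly R}) :
  `|\sum_(j < size q) q`_j| * p 1 <= p q.
Proof.
rewrite -average_normZ//; apply: le_trans (p_group (b := fun=> 0%N) q _) => //.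
by rewrite -scaler_suml expr0.
Qed.

Lemma average_norm_split (q : {poly R}) m :
  p ((\sum_(j < size q | (j < m)%N) q`_j) *: 1 + (\sum_(j < size q | ~~ (j < m)%N) q`_j) *: 'X)
    <= p q.
Proof.
apply: le_trans (p_group (b := fun j => (m <= j)%N : nat) q _).
  rewrite [X in _ <= _ X](bigID (fun j : 'I_(size q) => (j < m)%N))/= !scaler_suml.
  rewrite [X in _ <= p (X + _)](eq_bigr (fun j : 'I_(size q) => q`_j *: 1)) => [|j].
    rewrite [X in _ <= p (_ + X)](eq_bigr (fun j : 'I_(size q) => q`_j *: 'X))// => j.
    by rewrite -leqNgt => ->; rewrite expr1.
  by rewrite ltnNge => /negbTE ->; rewrite expr0.
by move=> i j ij /=; case: (leqP m i) => // mi; rewrite (leq_trans mi ij).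
Qed.

(** With [t] and [s] the head and tail sums, [t (1 - 'X)] is [t + s 'X] minus [(t + s) 'X]. Both are
    controlled by groupings, into two classes and into one. *)
Lemma average_norm_head (q : {poly R}) m :
  `|\sum_(j < size q | (j < m)%N) q`_j| * p (1 - 'X) <= 2 * p q.
Proof.
set t := \sum_(j < _ | _) _; set s := \sum_(j < size q | ~~ (j < m)%N) q`_j.
have ts : t + s = \sum_(j < size q) q`_j by rewrite [RHS](bigID (fun j : 'I_(size q) => (j < m)%N)).
rewrite -average_normZ//.
have -> : t *: (1 - 'X) = (t *: 1 + s *: 'X) + - ((t + s) *: 'X) :> {poly R}.
  by rewrite scalerBr scalerDl opprD [X in _ = _ + X]addrC addrA addrK.
rewrite (le_trans (average_normD _ _ se))// mulr_natl mulr2n lerD ?average_norm_split//.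
by rewrite average_normN// average_normZ// (average_normXn 1)// ts average_norm_total.
Qed.

Lemma average_norm_tail (q : {poly R}) m :
  `|\sum_(j < size q | ~~ (j < m)%N) q`_j| * p (1 - 'X) <= 2 * p q.
Proof.
set s := \sum_(j < _ | _) _; set t := \sum_(j < size q | (j < m)%N) q`_j.
have ts : t + s = \sum_(j < size q) q`_j by rewrite [RHS](bigID (fun j : 'I_(size q) => (j < m)%N)).
rewrite -average_normZ//.
have -> : s *: (1 - 'X) = (t + s) *: 1 + - (t *: 1 + s *: 'X) :> {poly R}.
  by rewrite scalerBr scalerDl opprD addrACA subrr add0r.
rewrite (le_trans (average_normD _ _ se))// mulr_natl mulr2n lerD//.
  by rewrite average_normZ// ts average_norm_total.
by rewrite average_normN// average_norm_split.
Qed.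

(** Merging all indices from [m] on into [m] keeps the head and adds [s 'X^m]; removing that term
    costs [bound], by the tail estimate. *)
Lemma average_norm_take m (q : {poly R}) : p (take_poly m q) <= (1 + bound) * p q.
Proof.
set s := \sum_(j < size q | ~~ (j < m)%N) q`_j.
have -> : take_poly m q = (take_poly m q + s *: 'X^m) + - (s *: 'X^m) by rewrite addrK.
rewrite (le_trans (average_normD _ _ se))// mulrDl mul1r lerD//.
  apply: le_trans (p_group (b := fun j => minn j m) q _).
    rewrite [X in _ <= _ X](bigID (fun j : 'I_(size q) => (j < m)%N))/= scaler_suml.
    rewrite le_eqVlt; apply/orP; left; apply/eqP; congr (p (_ + _)).
      rewrite /take_poly poly_def.
      rewrite [RHS](eq_bigr (fun j : 'I_(size q) => q`_j *: 'X^j)) => [|j jm]; last first.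
        by rewrite (minn_idPl (ltnW jm)).
      rewrite -(big_mkord (fun j => j < m)%N (fun j => q`_j *: 'X^j)).
      rewrite -(big_mkord xpredT (fun j => q`_j *: 'X^j)).
      rewrite (big_nat_widen 0 m (m + size q))%N ?leq_addr//.
      rewrite [RHS](big_nat_widen 0 (size q) (m + size q))%N ?leq_addl//.
      rewrite [LHS](bigID (fun j => j < size q)%N)/= [X in _ + X]big1 ?addr0.
        by apply: eq_bigl => j; rewrite andbC.
      by move=> j /andP[_]; rewrite -leqNgt => qj; rewrite nth_default// scale0r.
    by apply: eq_bigr => j; rewrite -leqNgt => mj; rewrite (minn_idPr mj).
  by move=> i j ij; rewrite leq_min geq_minr geq_min ij.
rewrite average_normN// average_normZ// average_normXn//.
rewrite /bound mulrAC ler_pdivlMr// [leLHS]mulrAC [leRHS]mulrAC.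
by rewrite ler_wpM2r ?average_norm_tail ?p_ge0.
Qed.

(** A coefficient is the difference of two consecutive head sums, each contributing a factor 2. *)
Lemma average_norm_coef i (q : {poly R}) : `|q`_i| <= 4 / p (1 - 'X) * p q.
Proof.
rewrite mulrAC ler_pdivlMr//.
have -> : q`_i = \sum_(j < size q | (j < i.+1)%N) q`_j - \sum_(j < size q | (j < i)%N) q`_j.
  rewrite big_mkcond [X in _ - X]big_mkcond -sumrB.
  have [qi|iq] := leqP (size q) i.
    rewrite nth_default// big1// => j _.
    by rewrite !(leq_trans (ltn_ord j))// ?subrr// ltnW.
  rewrite (bigD1 (Ordinal iq))//= ltnSn ltnn subr0 big1 ?addr0// => j.
  by rewrite -val_eqE/= ltnS leq_eqVlt => /negbTE ->; rewrite subrr.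
rewrite (le_trans (ler_wpM2r (p_ge0 _) (ler_normB _ _)))// mulrDl.
have := average_norm_head q i; have := average_norm_head q i.+1; lra.
Qed.

Lemma average_basis_norm : exists P : basis_norm R, bnorm P =1 p.
Proof.
have b0 : 0 <= bound by rewrite divr_ge0 ?mulr_ge0.
have c0 : 0 <= 4 / p (1 - 'X) by rewrite divr_ge0.
pose K := 1 + bound + 4 / p (1 - 'X).
have P1 q : (1 + bound) * p q <= K * p q by rewrite ler_wpM2r// lerDl.
have P2 q : 4 / p (1 - 'X) * p q <= K * p q by rewrite ler_wpM2r// lerDr addr_ge0.
unshelve eexists (@BasisNorm R p K _ _ _ _ _) => //.
- by move=> q r; exact: average_normD.
- by move=> c q; exact: average_normZ.
- by rewrite /K -addrA ltr_wpDr// addr_ge0.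
- by move=> m q; exact: le_trans (average_norm_take m q) (P1 q).
- by move=> m q; exact: le_trans (average_norm_coef m q) (P2 q).
Qed.

End Bounds.
End AveragingNorm.

(** * Suppression unconditionality *)

Section Unconditionality.
Context {R : realType} {X : completeNormedModType R}.
Implicit Types (x : nat -> X) (a : nat -> R).

(** A far block of the rearranged series is a subsum of a far block of the original one, so
    suppression transfers the Cauchy criterion. *)
Lemma suppression_unconditional_unconditional x :
  suppression_unconditional x -> unconditional x.
Proof.
move=> sx a ca s [t st ts]; apply: seq_cauchy_cvg => eps eps0.
have /cauchy_cvgP/cauchyP/(_ (eps / 2) ltac:(rewrite divr_gt0//))[y [N _ yN]] := ca.
have SN m : (N <= m)%N -> `|\sum_(N <= j < m) a j *: x j| <= eps.
  move=> Nm; have := yN _ Nm; have := yN _ (leqnn N); rewrite -ball_normE/= => y1 y2.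
  rewrite -sub_series_geq// -(subrKA y) (le_trans (ler_normD _ _))//.
  rewrite [leRHS]splitr distrC lerD ?ltW//.
(* [M] exceeds the new position [t i] of every index below [N], so from [M] on only indices at least
   [N] occur. *)
pose M := (\sum_(i < N) t i).+1.
have MN i : (M <= i)%N -> (N <= s i)%N.
  move=> Mi; rewrite leqNgt; apply/negP => siN.
  move: Mi; rewrite /M (bigD1 (Ordinal siN))//= st.
  by rewrite -addSn leqNgt ltnS leq_addr.
exists M => m Mm; rewrite distrC sub_series_geq//.
pose L := (N + \sum_(M <= i < m) (s i).+1)%N.
have sL i : (M <= i < m)%N -> (s i < L)%N.
  move=> iMm; rewrite /L (bigD1_seq i) ?mem_index_iota ?iota_uniq//=.
  by rewrite addnA addnAC leq_addl.
have -> : \sum_(M <= i < m) a (s i) *: x (s i) =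
    \sum_(j < L | (M <= t j < m)%N) (if (N <= j)%N then a j else 0) *: x j.
  rewrite -(big_map s xpredT (fun j => a j *: x j)).
  rewrite -(big_mkord (fun j => M <= t j < m)%N (fun j => (if (N <= j)%N then a j else 0) *: x j)).
  rewrite -[RHS]big_filter.
  rewrite (perm_big [seq j <- index_iota 0 L | (M <= t j < m)%N])/=; last first.
    apply: uniq_perm; rewrite ?filter_uniq ?iota_uniq// ?map_inj_uniq ?iota_uniq//.
      exact: can_inj st.
    move=> j; rewrite mem_filter mem_index_iota/=; apply/mapP/andP.
      move=> [i]; rewrite mem_index_iota => iMm ->; rewrite st; split=> //; exact: sL.
    by move=> [tj _]; exists (t j); rewrite ?mem_index_iota ?ts.
  rewrite !big_filter; apply: eq_bigr => j /andP[Mj _].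
  by have := MN _ Mj; rewrite ts => ->.
apply: le_trans (sx L (fun j => if (N <= j)%N then a j else 0) (fun j => M <= t j < m)%N) _.
apply: le_trans (SN L (leq_addr _ _)).
rewrite -(big_mkord xpredT (fun j => (if (N <= j)%N then a j else 0) *: x j)).
rewrite (big_cat_nat _ (n := N)) ?leq_addr//= big_nat big1 ?add0r; last first.
  by move=> j /andP[_ jN]; rewrite leqNgt jN scale0r.
rewrite le_eqVlt; apply/orP; left; apply/eqP; congr `|_|.
by rewrite big_nat [RHS]big_nat; apply: eq_bigr => j /andP[-> _].
Qed.

(* With [h] the vector in which the [k]-th term is deleted and moved apart,
   [h + a k *: v k s] has the norm of the original combination for all [s < N];
   average over [s]. *)
Lemma deletion_le x : one_spreading x ->
  (forall eps, 0 < eps -> exists N (v : nat -> nat -> X),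
    [/\ (0 < N)%N, forall k, `|N%:R^-1 *: \sum_(s < N) v k s| <= eps &
      forall n a k s, (s < N)%N ->
        `|\sum_(i < n) a i *: (if i == k :> nat then v k s
                               else x (if (i < k)%N then i : nat else (i + N)%N))|
          <= `|\sum_(i < n) a i *: x i| ]) ->
  suppression_unconditional x.
Proof.
move=> sx hx.
have del n a k : (k < n)%N ->
    `|\sum_(i < n) (if i == k :> nat then 0 else a i) *: x i| <= `|\sum_(i < n) a i *: x i|.
  move=> kn; apply/ler_addgt0Pr => eps eps0.
  have a0 : 0 < `|a k| + 1 by rewrite ltr_wpDl.
  have [N [v [N0 vN hv]]] := hx _ (divr_gt0 eps0 a0).
  pose g i := if (i < k)%N then i : nat else (i + N)%N.
  rewrite -(@spreading_upto _ _ _ n g (fun i => if i == k then 0 else a i) sx); last first.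
    move=> i j /andP[ij _]; rewrite /g; case: (ltnP j k) => jk.
      by rewrite (ltn_trans ij jk).
    by case: ifP => _; rewrite ?ltn_add2r// ltn_addr.
  set h := (X in `|X|).
  have -> : h = N%:R^-1 *: \sum_(s < N) (h + a k *: v k s)
      - a k *: (N%:R^-1 *: \sum_(s < N) v k s).
    rewrite big_split/= sumr_const card_ord scalerDr -[h *+ N]scaler_nat scalerA mulVf ?scale1r.
      by rewrite -scaler_sumr !scalerA mulrC addrK.
    by rewrite pnatr_eq0 -lt0n.
  rewrite (le_trans (ler_normB _ _))// lerD//.
    apply: (norm_average_le (v := fun s => h + a k *: v k s)) => // s sN.
    apply: le_trans (hv n a k s sN); rewrite le_eqVlt; apply/orP; left; apply/eqP; congr `|_|.
    rewrite /h (bigD1 (Ordinal kn))//= eqxx scale0r add0r.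
    rewrite [RHS](bigD1 (Ordinal kn))//= eqxx addrC; congr (_ + _).
    by apply: eq_bigr => i; rewrite -val_eqE/= => /negbTE ->.
  rewrite normrZ (le_trans (ler_wpM2l _ (vN k)))//.
  by rewrite mulrCA ger_pMr// ler_pdivrMr// mul1r lerDl.
move=> n a A.
(* The terms outside [A] are deleted one at a time, in increasing order. *)
have step m : (m <= n)%N ->
    `|\sum_(i < n) (if (i < m)%N && ~~ A i then 0 else a i) *: x i| <= `|\sum_(i < n) a i *: x i|.
  elim: m => [|m IH] mn; first by under eq_bigr do rewrite ltn0.
  apply: le_trans (IH (ltnW mn)).
  case: (boolP (A m)) => Am.
    rewrite le_eqVlt; apply/orP; left; apply/eqP; congr `|_|; apply: eq_bigr => i _.
    rewrite ltnS leq_eqVlt; case: eqVneq => //= ->; by rewrite Am andbF.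
  apply: le_trans (del n (fun i => if (i < m)%N && ~~ A i then 0 else a i) m mn).
  rewrite le_eqVlt; apply/orP; left; apply/eqP; congr `|_|; apply: eq_bigr => i _.
  by rewrite ltnS leq_eqVlt; case: eqVneq => //= ->; rewrite Am.
apply: le_trans (step n (leqnn n)); rewrite big_mkcond.
rewrite le_eqVlt; apply/orP; left; apply/eqP; congr `|_|; apply: eq_bigr => i _.
by rewrite ltn_ord/=; case: (A i); rewrite ?scale0r.
Qed.

(** Suppression bounds partial sums and coordinates. Hence finite combinations approximating [v]
    have convergent coefficients, and the limits give the expansion of [v]. *)
Lemma suppression_unconditional_basic x : suppression_unconditional x ->
  (forall i, x i != 0) -> basic_sequence x.
Proof.
move=> sx x0.
have head m n a : (m <= n)%N -> `|\sum_(i < m) a i *: x i| <= `|\sum_(i < n) a i *: x i|.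
  by move=> mn; rewrite (big_ord_widen n (fun i => a i *: x i) mn) (sx n a (fun i => i < m)%N).
have coord i n a : (i < n)%N -> `|a i| * `|x i| <= `|\sum_(j < n) a j *: x j|.
  move=> i_n; rewrite -normrZ; apply: le_trans (sx n a (fun j => j == i)).
  by rewrite (big_pred1 (Ordinal i_n)).
have xgt0 i : 0 < `|x i| by rewrite normr_gt0.
move=> v vx.
(* Coefficients vanish past the chosen length, so the same approximation can be written with any
   larger number of terms. *)
have approx (m : nat) : exists na : nat * (nat -> R),
    `|v - \sum_(i < na.1) na.2 i *: x i| < m.+1%:R^-1 /\
    (forall i, (na.1 <= i)%N -> na.2 i = 0).
  have m0 : 0 < m.+1%:R^-1 :> R by rewrite invr_gt0.
  have [_ [[n [a ->]] /=]] := vx _ (nbhsx_ballx v _ m0).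
  rewrite -ball_normE/= => vm; exists (n, fun i => if (i < n)%N then a i else 0); split=> /=.
    by under eq_bigr do rewrite ltn_ord.
  by move=> i; rewrite ltnNge => ->.
have [na hna] := choice approx.
pose n m := (na m).1; pose a m := (na m).2.
have vE m l : (n m <= l)%N -> `|v - \sum_(i < l) a m i *: x i| < m.+1%:R^-1.
  move=> nl; have [h h0] := hna m; move: h.
  rewrite (big_ord_widen l (fun i => a m i *: x i) nl) big_mkcond/=.
  congr (`|v - _| < _); apply: eq_bigr => i _.
  by case: ltnP => // /h0; rewrite -/(a m) => ->; rewrite scale0r.
(* Extend the sum to a length [L] at which both approximations of [v] are complete, then suppress
   the added terms. *)
have headle m l N : `|\sum_(i < N) (a m i - a l i) *: x i| <= m.+1%:R^-1 + l.+1%:R^-1.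
  pose L := maxn N (maxn (n m) (n l)).
  rewrite (le_trans (head N L (fun i => a m i - a l i) _)) ?leq_maxl//.
  under eq_bigr do rewrite scalerBl.
  rewrite sumrB -(subrKA v) (le_trans (ler_normD _ _))// distrC lerD// ltW// vE//.
    by rewrite !leq_max leqnn orbT.
  by rewrite !leq_max leqnn !orbT.
have inv_le eps : 0 < eps -> exists M, forall m, (M <= m)%N -> m.+1%:R^-1 <= eps :> R.
  move=> eps0; have [M hM] := eventually_div_le 1 eps0.
  by exists M => m Mm; rewrite -[leLHS]mul1r hM// ltnW.
have acvg i : cvgn (fun m => a m i).
  apply: (@seq_cauchy_cvg _ R) => eps eps0.
  have [M hM] := inv_le (eps * `|x i| / 2) ltac:(rewrite divr_gt0// mulr_gt0//).
  exists M => m Mm; rewrite -(ler_pM2r (xgt0 i)).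
  apply: le_trans (coord i i.+1 (fun i => a M i - a m i) (ltnSn i)) _.
  by rewrite (le_trans (headle _ _ _))// [leRHS]splitr lerD ?hM.
pose c i := limn (fun m => a m i).
have hlim m N : `|\sum_(i < N) (a m i - c i) *: x i| <= m.+1%:R^-1.
  have lim1 : `|\sum_(i < N) (a m i - a l i) *: x i| @[l --> \oo] -->
      `|\sum_(i < N) (a m i - c i) *: x i|.
    apply: cvg_norm; apply: cvg_big => [|i _]; first exact: add_continuous.
    by apply: cvgZr_tmp; apply: cvgB; [exact: cvg_cst | exact: acvg].
  apply/ler_addgt0Pr => eps /inv_le[M hM].
  rewrite -(cvg_lim _ lim1)//; apply: limr_le; first by apply/cvg_ex; eexists; exact: lim1.
  by exists M => // l /= Ml; rewrite (le_trans (headle _ _ _))// lerD2l hM.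
exists c; split.
  apply/cvgrPdist_le => eps eps0.
  have [M hM] := inv_le (eps / 2) ltac:(rewrite divr_gt0//).
  exists (n M) => // l /= Ml; rewrite /series/= big_mkord.
  rewrite -(subrKA (\sum_(i < l) a M i *: x i)) (le_trans (ler_normD _ _))//.
  rewrite [leRHS]splitr lerD//.
    by rewrite (le_trans (ltW (vE _ _ Ml)))// hM.
  rewrite -sumrB; under eq_bigr do rewrite -scalerBl.
  by rewrite (le_trans (hlim _ _))// hM.
move=> d dv; apply/funext => i; apply/eqP; rewrite -subr_eq0 -normr_le0.
rewrite -(pmulr_lle0 _ (xgt0 i)) //.
apply/ler_addgt0Pr => eps eps0; rewrite add0r.
have [M hM] := inv_le (eps / 3) ltac:(rewrite divr_gt0//).
have /cvgrPdist_le/(_ (eps / 3) ltac:(rewrite divr_gt0//))[N _ hN] := dv.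
pose l := (i.+1 + (N + n M))%N.
apply: le_trans (coord i l (fun i => c i - d i) (leq_addr _ _)) _.
(* Three errors of at most [eps / 3]: limit against approximation, approximation against [v], and
   [v] against its second expansion. *)
have -> : \sum_(j < l) (c j - d j) *: x j = - (\sum_(j < l) (a M j - c j) *: x j)
    - (v - \sum_(j < l) a M j *: x j) + (v - \sum_(j < l) d j *: x j).
  rewrite -sumrN -addrA opprB addrC subrKA.
  rewrite -!sumrB -big_split/=; apply: eq_bigr => j _.
  by rewrite -!scalerBl; congr (_ *: _); ring.
rewrite (le_trans (ler_normD _ _))// (le_trans (lerD (ler_normB _ _) (lexx _)))//.
rewrite normrN.
have h1 := hlim M l; have h2 := hM _ (leqnn M).
have h3 := vE M l ltac:(rewrite /l !addnA leq_addl//).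
have h4 := hN l ltac:(rewrite /= /l addnCA leq_addr//).
rewrite /series/= big_mkord in h4.
rewrite (le_trans (lerD (lerD (le_trans h1 h2) (le_trans (ltW h3) h2)) h4))//.
by rewrite le_eqVlt; apply/orP; left; apply/eqP; field.
Qed.

End Unconditionality.

(** * Conditional 1-spreading bases and skipped differences *)

Section ConditionalSpreading.
Context {R : realType} {X : completeNormedModType R}.
Implicit Types (e : nat -> X) (a : nat -> R).

Lemma average_norm_ge0 e (q : {poly R}) : one_spreading e -> 0 <= average_norm e q.
Proof.
move=> se; apply: limr_ge; first by apply/cvg_ex; eexists; exact: average_norm_cvg.
exact: nearW.
Qed.

(* If the averages of [e] tend to [0], replacing [e k] by an average deletes it. *)
Lemma average_norm1_gt0 e : one_spreading e -> ~ unconditional e -> 0 < average_norm e 1.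
Proof.
move=> se; apply: contra_notT; rewrite -leNgt => p1.
have {}p1 : average_norm e 1 = 0.
  by apply/eqP; rewrite eq_le p1 average_norm_ge0.
apply: suppression_unconditional_unconditional.
apply: deletion_le => // eps eps0.
have /cvgrPdist_le/(_ eps eps0)[M _ hM] := average_norm_cvg (q := 1) se.
(* The gap opened at [k] has room for [e k, .., e (k + M)], whose average has the norm of the first
   average of length [M.+1]. *)
exists M.+1, (fun k s => e (k + s)%N); split=> // [k|n a k s sM].
  have := hM _ (leqnSn M); rewrite p1 sub0r normrN normr_id.
  rewrite -(expr0 'X) average_mapXn averageE !normrZ.
  have := @spreading_upto _ _ e M.+1 (fun s => k + s)%N (fun=> 1) se.
  under eq_bigr do rewrite scale1r.
  under [in RHS]eq_bigr do rewrite scale1r.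
  move=> -> //.
  by move=> i j /andP[ij _]; rewrite ltn_add2l.
rewrite -(@spreading_upto _ _ e n (fun i => if i == k then k + s else
  if (i < k)%N then i else i + M.+1)%N a se).
  rewrite le_eqVlt; apply/orP; left; apply/eqP; congr `|_|; apply: eq_bigr => i _.
  by case: (i == k :> nat).
move=> i j /andP[ij _].
by case: eqP => ik; case: eqP => jk; case: (ltnP i k) => ?; case: (ltnP j k) => ?; lia.
Qed.

Lemma average_mul e N K : (0 < N)%N -> (0 < K)%N ->
  average e (K * N) 0 = K%:R^-1 *: \sum_(j < K) average e N j.
Proof.
move=> N0 K0; rewrite averageE.
under [in RHS]eq_bigr do rewrite averageE.
rewrite -scaler_sumr (sum_divmod K (fun j s => e (j * N + s)%N))// scalerA.
rewrite natrM invfM; congr (_ *: _); apply: eq_bigr => t _.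
by rewrite -divn_eq.
Qed.

Lemma average_norm_1BX_cvg e : one_spreading e ->
  `|average e N 0 - average e N 1| @[N --> \oo] --> average_norm e (1 - 'X).
Proof.
move=> se; under eq_cvg do
  rewrite -[average e _ 0]average_mapXn -[average e _ 1]average_mapXn -linearB/=.
exact: average_norm_cvg.
Qed.

(** The longer average is the mean of [K] averages of length [N], and each of these other than the
    first is at the same distance from the first, by spreading. *)
Lemma average_mul_dist e N K : one_spreading e -> (0 < N)%N -> (0 < K)%N ->
  `|average e N 0 - average e (K * N) 0| <= `|average e N 0 - average e N 1|.
Proof.
move=> se N0 K0; rewrite average_mul//.
have -> : average e N 0 - K%:R^-1 *: \sum_(j < K) average e N j =
    K%:R^-1 *: \sum_(j < K) (average e N 0 - average e N j).
  rewrite sumrB sumr_const card_ord scalerBr -[average e N 0 *+ K]scaler_nat.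
  rewrite scalerA mulVf ?scale1r//.
  by rewrite pnatr_eq0 -lt0n.
apply: (norm_average_le (v := fun j => average e N 0 - average e N j)) => // -[|j] _.
  by rewrite subrr normr0.
pose a i : R := if i == 0%N then 1 else -1.
have := @average_spreading _ _ e 2 N a (fun i => if i == 0%N then 0%N else j.+1) se.
rewrite !big_ord_recr !big_ord0/= !add0r /a/= !scale1r !scaleN1r => ->// i l /andP[il l2].
by case: l i il l2 => [|[|l]] [|i].
Qed.

(* Otherwise the averages converge to a nonzero shift-invariant vector, which
   has no expansion along [e]. *)
Lemma average_norm_1BX_gt0 e : schauder_basis e -> one_spreading e ->
  0 < average_norm e 1 -> 0 < average_norm e (1 - 'X).
Proof.
move=> be se p1; rewrite ltNge; apply/negP => le0.
have g0 := average_norm_1BX_cvg se.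
have {le0}p0 : average_norm e (1 - 'X) = 0 by apply/eqP; rewrite eq_le le0 average_norm_ge0.
rewrite {}p0 in g0.
(* Two averages are compared through the one whose length is the product of their lengths. *)
have Acvg : cvgn (fun N => average e N 0).
  apply: seq_cauchy_cvg => eps eps0.
  have /cvgrPdist_le/(_ (eps / 2) ltac:(rewrite divr_gt0//))[M _ hM] := g0.
  have {}hM N : (M < N)%N -> `|average e N 0 - average e N 1| <= eps / 2.
    by move=> MN; have := hM N (ltnW MN); rewrite sub0r normrN normr_id.
  exists M.+1 => N MN; have N0 : (0 < N)%N by exact: leq_trans MN.
  rewrite -(subrKA (average e (N * M.+1) 0)) (le_trans (ler_normD _ _))// [leRHS]splitr.
  apply: lerD; first exact: le_trans (average_mul_dist se _ N0) (hM _ _).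
  rewrite distrC mulnC; exact: le_trans (average_mul_dist se N0 _) (hM _ MN).
have [f Af] := (cvg_ex _).1 Acvg.
have [b [bf b_uniq]] := be f I.
pose b' i := if i is j.+1 then b j else 0.
(* Replace [f] by a long average: shifting all of [e] by one preserves norms and moves that average
   by only [O(1/N)]. *)
have shift n : `|f - \sum_(i < n) b i *: e i.+1| <= `|f - \sum_(i < n) b i *: e i|.
  rewrite -subr_le0.
  have h : `|average e N 0 - \sum_(i < n) b i *: e i.+1| -
      `|average e N 0 - \sum_(i < n) b i *: e i| @[N --> \oo] -->
      `|f - \sum_(i < n) b i *: e i.+1| - `|f - \sum_(i < n) b i *: e i|.
    by apply: cvgB; apply: cvg_norm; apply: cvgB => //; exact: cvg_cst.
  apply: (limit_le_div (C := 1%:R * (2 * `|e 0%N|)) h) => N N0; rewrite add0r lerBlDr.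
  pose L := maxn N n.
  pose c i := (if (i < N)%N then N%:R^-1 else 0) - (if (i < n)%N then b i else 0).
  have cE (k : nat -> nat) :
      N%:R^-1 *: \sum_(s < N) e (k s) - \sum_(i < n) b i *: e (k i) = \sum_(i < L) c i *: e (k i).
    under [RHS]eq_bigr do rewrite scalerBl.
    rewrite sumrB scaler_sumr; congr (_ - _).
      rewrite (big_ord_widen L (fun s => N%:R^-1 *: e (k s)) (leq_maxl _ _)) big_mkcond/=.
      by apply: eq_bigr => i _; case: ifP => //; rewrite scale0r.
    rewrite (big_ord_widen L (fun s => b s *: e (k s)) (leq_maxr _ _)) big_mkcond/=.
    by apply: eq_bigr => i _; case: ifP => //; rewrite scale0r.
  have Nn0 : N%:R != 0 :> R by rewrite pnatr_eq0 -lt0n.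
  have E0 : average e N 0 = N%:R^-1 *: \sum_(s < N) e s by rewrite averageE.
  have sp : `|N%:R^-1 *: \sum_(s < N) e s.+1 - \sum_(i < n) b i *: e i.+1| =
      `|average e N 0 - \sum_(i < n) b i *: e i|.
    by rewrite E0 (cE succn) (cE id) (@spreading_upto _ _ e L succn c se)// => i j /andP[].
  rewrite -sp -(subrKA (N%:R^-1 *: \sum_(s < N) e s.+1)).
  rewrite (le_trans (ler_normD _ _))// lerD// distrC E0 -scalerBr.
  rewrite normrZ gtr0_norm ?invr_gt0 ?ltr0n// mulrC ler_pM2r ?invr_gt0 ?ltr0n//.
  exact: (shift_sum_le 0 1 N se).
have b'f : series (fun i => b' i *: e i) @ \oo --> f.
  apply/cvgrPdist_le => eps eps0.
  have /cvgrPdist_le/(_ eps eps0)[M _ hM] := bf.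
  exists M.+1 => // -[//|n] /= Mn; have := hM _ Mn.
  rewrite /series/= !big_mkord big_ord_recl/= scale0r add0r.
  by apply: le_trans; exact: shift.
(* Uniqueness forces [b 0 = 0] and [b i.+1 = b i]. So [f = 0], although its norm is
   [average_norm e 1]. *)
have bb' := b_uniq _ b'f.
have b0 i : b i = 0 by elim: i => [|i IH]; rewrite bb'.
have f0 : f = 0.
  rewrite -(cvg_lim _ bf)//; apply: cvg_lim => //.
  by apply: cvg_near_cst; apply: nearW => n; rewrite /series/= big1// => i _; rewrite b0 scale0r.
have h := average_norm_cvg (q := 1) se.
have E : average_norm e 1 = `|f|.
  rewrite -(cvg_lim _ h)//; under eq_fun do rewrite -(expr0 'X) average_mapXn.
  by apply: cvg_lim => //; exact: cvg_norm.
by move: p1; rewrite E f0 normr0 ltxx.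
Qed.

(** * Differences over successive pairs *)

(** Listing the end points as [l 0, r 0, l 1, r 1, ..] gives a strictly increasing reindexing, with
    signs -1 at even and 1 at odd places; 1-spreading then applies. *)
Lemma pairs_spreading e n a (l r : nat -> nat) : one_spreading e ->
  (forall i, (i < n)%N -> (l i < r i)%N) ->
  (forall i j, (i < j < n)%N -> (r i < l j)%N) ->
  `|\sum_(i < n) a i *: (e (r i) - e (l i))| =
  `|\sum_(i < n) a i *: skipped_difference e i|.
Proof.
move=> se lr rl.
pose c t := (if (t %% 2 == 0)%N then -1 else 1) * a (t %/ 2)%N.
have flat (l' r' : nat -> nat) : \sum_(i < n) a i *: (e (r' i) - e (l' i)) =
    \sum_(t < n * 2) c t *: e (if (t %% 2 == 0)%N then l' (t %/ 2)%N else r' (t %/ 2)%N).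
  rewrite -(sum_divmod n (fun i s => ((if s == 0%N then -1 else 1) * a i) *:
    e (if s == 0%N then l' i else r' i)))//.
  apply: eq_bigr => i _; rewrite !big_ord_recr big_ord0/= add0r mulN1r mul1r scaleNr.
  by rewrite scalerBr addrC.
rewrite /skipped_difference flat (flat (fun i => i.*2) (fun i => i.*2.+1)).
rewrite (@spreading_upto _ _ e (n * 2)
  (fun t => if (t %% 2 == 0)%N then l (t %/ 2)%N else r (t %/ 2)%N) c se).
  rewrite (@spreading_upto _ _ e (n * 2)
    (fun t => if (t %% 2 == 0)%N then (t %/ 2).*2 else (t %/ 2).*2.+1) c se)//.
  move=> i j /andP[ij _].
  case: eqP => i2; case: eqP => j2; have := divn_eq i 2; have := divn_eq j 2; lia.
move=> i j /andP[ij jn].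
have jn2 : (j %/ 2 < n)%N by rewrite ltn_divLR.
have [ij2|ij2] := eqVneq (i %/ 2)%N (j %/ 2)%N.
  have i2 : (i %% 2 = 0)%N by have := divn_eq i 2; have := divn_eq j 2; lia.
  have j2 : (j %% 2 = 1)%N by have := divn_eq i 2; have := divn_eq j 2; lia.
  by rewrite i2 j2 ij2 lr.
have lt2 : (i %/ 2 < j %/ 2)%N by rewrite ltn_neqAle ij2 leq_div2r// ltnW.
have h1 := lr _ (ltn_trans lt2 jn2); have h2 := lr _ jn2.
have h3 := rl (i %/ 2)%N (j %/ 2)%N ltac:(rewrite lt2//).
by case: ifP => _; case: ifP => _; lia.
Qed.

Lemma skipped_difference_spreading e : one_spreading e -> one_spreading (skipped_difference e).
Proof.
move=> se k hk n a; symmetry.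
apply: (@pairs_spreading e n a (fun i => (k i).*2) (fun i => (k i).*2.+1)) => // i j /andP[ij _].
by have := hk _ _ ij; lia.
Qed.

(* The average of the consecutive differences [e (2 k + s + 1) - e (2 k + s)]
   telescopes. *)
Lemma skipped_difference_suppression e : one_spreading e ->
  suppression_unconditional (skipped_difference e).
Proof.
move=> se; apply: deletion_le; first exact: skipped_difference_spreading.
move=> eps eps0; have [M hM] := eventually_div_le (2 * `|e 0%N|) eps0.
exists M.+1, (fun k s => e (k.*2 + s).+1 - e (k.*2 + s)%N); split=> // [k|n a k s sM].
  rewrite normrZ gtr0_norm ?invr_gt0 ?ltr0n// mulrC (le_trans _ (hM _ (leqnSn M)))//.
  rewrite ler_pM2r ?invr_gt0 ?ltr0n// sumrB.
  have := shift_sum_le k.*2 1 M.+1 se; rewrite mul1r.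
  by under eq_bigr do rewrite addn1 addSn.
(* Pairs after the [k]-th move by [M.+1] pairs, leaving room for the [k]-th one to slide by [s]. *)
pose l i := (if i == k then k.*2 + s else (if i < k then i else i + M.+1).*2)%N.
rewrite -(@pairs_spreading e n a l (fun i => (l i).+1) se) => //.
  rewrite le_eqVlt; apply/orP; left; apply/eqP; congr `|_|; apply: eq_bigr => i _.
  by rewrite /l /skipped_difference; case: ifP.
move=> i j /andP[ij _]; rewrite /l.
by case: eqP => ik; case: eqP => jk; case: (ltnP i k) => ?; case: (ltnP j k) => ?; lia.
Qed.

(** All skipped differences have the norm of [e 1 - e 0], which dominates [average_norm e (1 - 'X)]
    by grouping along the identity. *)
Lemma skipped_difference_norm_gt0 e i : one_spreading e ->
  0 < average_norm e (1 - 'X) -> skipped_difference e i != 0.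
Proof.
move=> se; apply: contraTneq => ui0; rewrite -leNgt.
have := @pairs_spreading e 1 (fun=> 1) (fun=> 0%N) (fun=> 1%N) se.
rewrite !big_ord1 !scale1r => /(_ (fun _ _ => isT)) e10.
have := @pairs_spreading e 1 (fun=> 1) (fun=> i.*2) (fun=> i.*2.+1) se.
rewrite !big_ord1 !scale1r -[e _ - e _]/(skipped_difference e i) ui0 normr0 => ei0.
have {}e10 : `|e 1%N - e 0%N| = 0.
  by rewrite e10 -?ei0// => j m /andP[/[swap]]; rewrite ltnS leqn0 => /eqP ->.
have := @average_norm_group_le _ _ e 2 id (fun j => if j == 0%N then 1 else -1) se (fun _ _ h => h).
rewrite !big_ord_recr !big_ord0/= !add0r !scale1r !scaleN1r expr0 expr1.
by rewrite distrC e10.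
Qed.

Lemma skipped_difference_subsymmetric e : one_spreading e ->
  0 < average_norm e (1 - 'X) -> subsymmetric (skipped_difference e).
Proof.
move=> se eta; have su := skipped_difference_suppression se; split.
- by apply: suppression_unconditional_basic => // i; exact: skipped_difference_norm_gt0.
- exact: suppression_unconditional_unconditional.
- move=> k hk; exists 1, 1; split=> // n a.
  by rewrite !mul1r (skipped_difference_spreading se hk n a) lexx.
Qed.

(** The odd and the even terms each form a spread copy of the sum along [e]. *)
Lemma skipped_difference_le e n a : one_spreading e ->
  `|\sum_(i < n) a i *: skipped_difference e i| <= 2 * `|\sum_(i < n) a i *: e i|.
Proof.
move=> se; under eq_bigr do rewrite scalerBr.
rewrite sumrB (le_trans (ler_normB _ _))// mulr_natl mulr2n.
by rewrite (@spreading_upto _ _ e n (fun i => i.*2.+1) a se)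
  ?(@spreading_upto _ _ e n double a se)// => i j /andP[ij _]; lia.
Qed.

(* Each [e (2 i N)] is compared with the average of [e] over the block
   [(2 i + 1) N, .., (2 i + 2) N - 1] that follows it. *)
Lemma norm_le_skipped_average e n a : one_spreading e ->
  `|\sum_(i < n) a i *: e i| <= `|\sum_(i < n) a i *: skipped_difference e i|
    + average_norm e (\sum_(i < n) a i *: 'X^i).
Proof.
move=> se; rewrite -lerBlDl.
apply: limr_ge; first by apply/cvg_ex; eexists; exact: average_norm_cvg.
exists 1%N => // N /= N0; rewrite lerBlDl (average_map_sum e N n a id).
rewrite -(@average_spreading _ _ e n N a (fun i => i.*2.+1) se); last first.
  by move=> i j /andP[ij _]; lia.
rewrite -(@spreading_upto _ _ e n (fun i => i.*2 * N)%N a se); last first.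
  by move=> i j /andP[ij _]; rewrite ltn_pmul2r//; lia.
set A := (X in _ + `|X|); set B := (X in `|X| <= _).
have -> : B = - (A - B) + A by rewrite opprB subrK.
rewrite (le_trans (ler_normD _ _))// normrN lerD2r.
pose v s := \sum_(i < n) a i *: (e (i.*2.+1 * N + s)%N - e (i.*2 * N)%N).
have -> : A - B = N%:R^-1 *: \sum_(s < N) v s.
  rewrite exchange_big/= scaler_sumr -sumrB; apply: eq_bigr => i _.
  rewrite averageE -scaler_sumr sumrB sumr_const card_ord -[e _ *+ N]scaler_nat.
  rewrite -scalerBr [RHS]scalerA [_^-1 * _]mulrC -scalerA; congr (_ *: _).
  by rewrite scalerBr scalerA mulVf ?scale1r// pnatr_eq0 -lt0n.
apply: norm_average_le => // s sN.
rewrite /v (@pairs_spreading e n a (fun i => i.*2 * N)%N (fun i => i.*2.+1 * N + s)%N se)//.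
  by move=> i _; rewrite mulSn; lia.
move=> i j /andP[ij _]; apply: (@leq_trans (i.*2.+2 * N)%N).
  by rewrite [(i.*2.+2 * N)%N]mulSn; lia.
by rewrite leq_mul2r; apply/orP; right; lia.
Qed.

End ConditionalSpreading.

(** * The space Z, its basis, and the conclusion *)

Lemma convex_block_sequence_finite (R : realType) (X : completeNormedModType R)
    (x w : nat -> X) n : infinite_convex_block_sequence x w ->
  finite_convex_block_sequence n x w.
Proof.
move=> [F [c [Flt c0 c1 wE]]]; exists F, c; split.
- by move=> k l i j _ _; exact: Flt.
- by move=> k i _; exact: c0.
- by move=> k _; exact: c1.
- by move=> k _; exact: wE.
Qed.

Section CompletedAverageNorm.
Context {R : realType} {X : completeNormedModType R}.
Context (e : nat -> X) (se : one_spreading e).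
Context (P : basis_norm R) (PE : bnorm P =1 average_norm e).

Lemma cbasis_norm n (a : nat -> R) :
  `|\sum_(i < n) a i *: cbasis P i| = average_norm e (\sum_(i < n) a i *: 'X^i).
Proof. by rewrite cbasis_sum cpoly_norm PE /trunc poly_def. Qed.

(** This makes the results on convex blocks of 1-spreading sequences available for the new basis
    itself. *)
Lemma cbasis_spreading : one_spreading (cbasis P).
Proof.
move=> k hk n a; rewrite cbasis_norm.
have -> : \sum_(i < n) a i *: (cbasis P \o k) i = cpoly P (\sum_(i < n) a i *: 'X^(k i)).
  by rewrite linear_sum; apply: eq_bigr => i _; rewrite linearZ.
by rewrite cpoly_norm PE average_norm_spreading// => i j /andP[ij _]; exact: hk.
Qed.

(** One inequality is [convex_block_le] for the new basis. The other regroups the blocks and uses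
    that grouping decreases [average_norm e]. *)
Lemma cbasis_convex_block_homogeneous : one_convex_block_homogeneous (cbasis P).
Proof.
have fin n w : finite_convex_block_sequence n (cbasis P) w ->
    isometrically_equivalent_upto n (cbasis P) w.
  move=> hw a; apply/eqP; rewrite eq_le (convex_block_le a cbasis_spreading hw) andbT.
  have [L [b [c [hb -> avE]]]] := convex_block_regroup a hw.
  by rewrite !cbasis_norm avE average_norm_group.
split=> //.
- by move=> x _; exact: cbasis_schauder.
- move=> w hw n; apply: fin; exact: convex_block_sequence_finite.
Qed.

End CompletedAverageNorm.

Theorem theorem4p1 (R : realType) (X : completeNormedModType R)
    (e : nat -> X) (he : conditional_one_spreading_basis e) :
  let u := skipped_difference e in
  (exists (Z : completeNormedModType R) (z : nat -> Z),
    [/\ schauder_basis z,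
        one_convex_block_homogeneous z,
        forall (n : nat) (a : nat -> R),
          2^-1 * Num.max `|\sum_(i < n) a i *: u i| `|\sum_(i < n) a i *: z i|
            <= `|\sum_(i < n) a i *: e i|
            <= 2 * Num.max `|\sum_(i < n) a i *: u i|
                           `|\sum_(i < n) a i *: z i|,
        forall (n : nat) (a : nat -> R),
          `|\sum_(i < n) a i *:
              (N%:R^-1 *: \sum_(i * N <= j < i.+1 * N) e j)| @[N --> \oo]
            --> `|\sum_(i < n) a i *: z i|
      & forall (n : nat) (a : nat -> R),
          `|\sum_(i < n) a i *: z i| =
            inf [set r : R | exists w : nat -> X,
                   finite_convex_block_sequence n e w /\
                   r = `|\sum_(i < n) a i *: w i|]])
  /\ subsymmetric u
  /\ suppression_unconditional u.
Proof.
move=> u; have [be se nu] := he.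
have p1 := average_norm1_gt0 se nu.
have eta := average_norm_1BX_gt0 be se p1.
split; last first.
  by split; [exact: skipped_difference_subsymmetric | exact: skipped_difference_suppression].
have [P PE] := average_basis_norm se eta.
exists (completion P), (cbasis P); split.
- exact: cbasis_schauder.
- exact: cbasis_convex_block_homogeneous PE.
- move=> n a; rewrite (cbasis_norm PE).
  (* The lower bound uses factor 2 for [u] and factor 1 for [z], the latter by identity grouping;
     the upper bound replaces a sum of two norms by twice their maximum. *)
  have h1 := skipped_difference_le n a se.
  have h2 := average_norm_group_le n a se (fun i j (ij : (i <= j)%N) => ij).
  have h3 := norm_le_skipped_average n a se.
  have e0 : 0 <= `|\sum_(i < n) a i *: e i| by [].
  rewrite -/u in h1 h3; apply/andP; split.
    by rewrite ler_pdivrMl// ge_max h1/= (le_trans h2)// ler_peMl// ler1n.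
  rewrite (le_trans h3)// mulr_natl mulr2n lerD// le_max lexx ?orbT//.
- by move=> n a; rewrite (cbasis_norm PE); exact: (average_norm_sum_cvg (g := id) se).
- by move=> n a; rewrite (cbasis_norm PE) average_norm_inf.
Qed.
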